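(* Let $(\mathsf X,\mathsf A,\{\mathsf A(x)\}_{x\in\mathsf X},Q,c)$ be a Markov control process with set of feasible pairs $\mathsf K$, let $w_0:\mathsf X\to[0,\infty)$ be Borel measurable, let $\mathcal R$ be a risk map on $\mathscr B_{1+w_0}$, and put $\mathcal T_{x,a}(v):=c(x,a)+\mathcal R_{x,a}(v)$. Assume there are constants $\gamma_0\in(0,1)$, $K_0>0$ and $K>K_0$ such that: (A1) $\max\{\mathcal T_{x,a}(w_0),\,-\mathcal T_{x,a}(-w_0)\}\le \gamma_0 w_0(x)+K_0$ for all $(x,a)\in\mathsf K$; (A2) $\mathcal R_{x,a}(w_0+K)-\mathcal R_{x,a}(v)+\mathcal R_{y,b}(v)-\mathcal R_{y,b}(-w_0-K)\ge 2K_0$ for all $v\in\mathscr B_{1+w_0}$ with $|v|\le w_0+K$, all $x,y\in\{x\in\mathsf X:w_0(x)\le\frac{2K_0}{1-\gamma_0}\}$, $a\in\mathsf A(x)$, $b\in\mathsf A(y)$. Set $w:=1+K^{-1}w_0$. Suppose moreover: (B1) there exist constants $\gamma\in(0,1)$, $\bar K>0$ and an upper envelope $\bar{\mathcal R}^{(w,K)}$ of $\mathcal R$ given the bound $K$ such that $\bar{\mathcal R}^{(w,K)}_{x,a}(w_0)\le\gamma w_0(x)+\bar K$ for all $(x,a)\in\mathsf K$; (B2) there exist $\alpha\in(0,1)$ and a Borel probability measure $\mu$ on $\mathsf X$ with $\int w_0\,d\mu<\infty$ such that $$\bar{\mathcal R}^{(w,K)}_{x,a}(v)-\bar{\mathcal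 R}^{(w,K)}_{x,a}(u)\ge\alpha\int(v-u)\,d\mu$$ for all $x\in\mathsf B:=\{x\in\mathsf X:w_0(x)\le R\}$, $a\in\mathsf A(x)$ and $v\ge u$ in $\mathscr B_{1+w_0}$, for some $R>\frac{2\bar K}{1-\gamma}$. Then there exist constants $\bar\alpha\in(0,1)$ and $\beta>0$ such that $$\|\mathcal R^\pi(v)-\mathcal R^\pi(u)\|_{s,1+\beta w_0}\le\bar\alpha\,\|v-u\|_{s,1+\beta w_0}\qquad\text{for all } v,u\in\mathscr B_w^{(K)},\ \pi\in\Delta.$$
   Context: Markov control process: $\mathsf X$ (states) and $\mathsf A$ (actions) are Borel spaces (Borel subsets of complete separable metric spaces); for each $x\in\mathsf X$, $\mathsf A(x)\subset\mathsf A$ is a nonempty Borel set of feasible actions; $\mathsf K:=\{(x,a):x\in\mathsf X,a\in\mathsf A(x)\}$ is a Borel subset of $\mathsf X\times\mathsf A$; $Q$ is a stochastic kernel on $\mathsf X$ given $\mathsf K$, with $Q_{x,a}(\cdot):=Q(\cdot|x,a)$; $c:\mathsf K\to\mathbb R$ is Borel measurable. $\Delta$ is the set of stochastic kernels $\pi$ on $\mathsf A$ given $\mathsf X$ with $\pi(\mathsf A(x)|x)=1$ for all $x$. Weighted spaces: for measurable $w:\mathsf X\to[1,\infty)$, $\|u\|_w:=\sup_x |u(x)|/w(x)$, $\mathscr B_w$ is the space of real-valued Borel functions on $\mathsf X$ with $\|u\|_w<\infty$, and $\|v\|_{s,w}:=\sup_{x\ne y}\frac{|v(x)-v(y)|}{w(x)+w(y)}$;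 $\mathscr B_w^{(K)}:=\{v\in\mathscr B_w:\|v\|_{s,w}\le K\}$. Note $\mathscr B_{1+\beta w_0}=\mathscr B_{1+w_0}$ for every $\beta>0$. Real numbers are identified with constant functions; $\le$ between functions is pointwise. Risk map: let $\mathscr P$ be the set of Borel probability measures on $\mathsf X$. A risk measure is $\nu:\mathscr B_w\times\mathscr P\to\mathbb R\cup\{\pm\infty\}$ such that for each $\mu\in\mathscr P$: $\nu(v,\mu)\le\nu(u,\mu)$ whenever $v\le u$; $\nu(v+r,\mu)=\nu(v,\mu)+r$ for $r\in\mathbb R$; $\nu(0,\mu)=0$. A risk map on $\mathscr B_w$ is $\mathcal R:\mathscr B_w\times\mathsf K\to\mathbb R$, written $\mathcal R_{x,a}(v)=\mathcal R(v|x,a)$, such that for each $(x,a)$ one has $\mathcal R_{x,a}(\cdot)=\nu(\cdot,Q_{x,a})$ for some risk measure $\nu$, and $(x,a)\mapsto\mathcal R(v|x,a)$ is Borel measurable for each $v$. It is coherent if each $\mathcal R_{x,a}$ is convex and satisfies $\mathcal R_{x,a}(\lambda v)=\lambda\mathcal R_{x,a}(v)$ for $\lambda\ge0$. For $\pi\in\Delta$, $\mathcal R^\pi(v)$ is the function $\mathcal R^\pi_x(v):=\int_{\mathsf A(x)}\mathcal R_{x,a}(v)\,\pi(da|x)$. Upper envelope: a coherent risk map $\bar{\mathcal R}^{(w,K)}$ on $\mathscr B_w$ is an upper envelope of $\mathcal R$ given the bound $K>0$ if $\mathcal R_{x,a}(v)-\mathcal R_{x,a}(u)\le\bar{\mathcal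 R}^{(w,K)}_{x,a}(v-u)$ for all $v,u\in\mathscr B_w^{(K)}$ and $(x,a)\in\mathsf K$. *)

(* Defs.v *)
From HB Require Import structures.
From mathcomp Require Import all_boot all_order all_algebra.
From mathcomp Require Import all_classical all_reals all_analysis.
From mathcomp Require Import measurable_realfun.

Set Implicit Arguments.
Unset Strict Implicit.
Unset Printing Implicit Defensive.

Import Order.TTheory GRing.Theory Num.Theory.
Import numFieldNormedType.Exports.

Local Open Scope classical_set_scope.
Local Open Scope ring_scope.

Definition polish_metric (R : realType) (M : metricType R) : Prop :=
  (forall F : set_system M, ProperFilter F -> cauchy F -> exists m : M, F --> m)
  /\ (exists2 D : set M, countable D & dense D).

(** A Borel space is presented as a measurable space together with the
    inclusion map [f] of its points into the ambient complete separable metric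
    space: the image is a Borel set, and the measurable sets are exactly the
    traces of the Borel sets of the ambient space. *)
Definition borel_space (R : realType) (d : measure_display)
    (T : measurableType d) : Prop :=
  exists (M : metricType R) (f : T -> M),
    [/\ polish_metric M, injective f, <<s @open M >> (range f) &
        forall B : set T,
          measurable B <-> exists2 C, <<s @open M >> C & B = f @^-1` C].

Section markov_control_process.
Context (R : realType) (dX dA : measure_display).
Context (X : measurableType dX) (A : measurableType dA).

(** [mcp_Q] and [mcp_cost] are total functions, but they are constrained, and
    will be used, on the feasible pairs only. *)
Record mcp := MCP {
  mcp_feasible : X -> set A;
  mcp_Q : X * A -> probability X R;
  mcp_cost : X * A -> R;
  mcp_states_borel : borel_space R X;
  mcp_actions_borel : borel_space R A;
  mcp_feasible_neq0 : forall x, mcp_feasible x !=set0;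
  mcp_feasible_measurable : forall x, measurable (mcp_feasible x);
  mcp_pairs_measurable : measurable [set p : X * A | mcp_feasible p.1 p.2];
  mcp_Q_measurable : forall B : set X, measurable B ->
    measurable_fun [set p : X * A | mcp_feasible p.1 p.2]
                   (mcp_Q ^~ B);
  mcp_cost_measurable :
    measurable_fun [set p : X * A | mcp_feasible p.1 p.2] mcp_cost
}.

Definition feasible_pairs (m : mcp) : set (X * A) :=
  [set p | mcp_feasible m p.1 p.2].

Definition policy (m : mcp) (pi : R.-pker X ~> A) : Prop :=
  forall x, pi x (mcp_feasible m x) = 1%E.

Definition wnorm (w u : X -> R) : \bar R :=
  ereal_sup [set (`|u x| / w x)%:E | x in [set: X]].

(** [maxe 0] only matters when [X] is a singleton, where the supremum over the
    empty set of pairs [x != y] is to be read as 0 instead of -oo. *)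
Definition wseminorm (w v : X -> R) : \bar R :=
  maxe 0%E (ereal_sup [set (`|v p.1 - v p.2| / (w p.1 + w p.2))%:E
                    | p in [set p : X * X | p.1 <> p.2]]).

Definition Bw (w : X -> R) : set (X -> R) :=
  [set u | measurable_fun [set: X] u /\ (wnorm w u < +oo)%E].

Definition BwK (w : X -> R) (K : R) : set (X -> R) :=
  [set v | Bw w v /\ (wseminorm w v <= K%:E)%E].

Definition risk_measure (w : X -> R)
    (nu : (X -> R) -> probability X R -> \bar R) : Prop :=
  forall mu : probability X R,
  [/\ forall v u, Bw w v -> Bw w u -> (forall x, v x <= u x) ->
        (nu v mu <= nu u mu)%E,
      forall v (r : R), Bw w v ->
        nu (fun x => v x + r) mu = (nu v mu + r%:E)%E
    & nu (fun=> 0) mu = 0%E].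

(** The values of [Rm v p] are meaningful for [v] in [Bw w] and [p] feasible
    only. *)
Definition risk_map (m : mcp) (w : X -> R) (Rm : (X -> R) -> X * A -> R)
    : Prop :=
  (forall p, feasible_pairs m p ->
     exists2 nu, risk_measure w nu &
       forall v, Bw w v -> (Rm v p)%:E = nu v (mcp_Q m p)) /\
  (forall v, Bw w v -> measurable_fun (feasible_pairs m) (Rm v)).

Definition coherent (m : mcp) (w : X -> R) (Rm : (X -> R) -> X * A -> R)
    : Prop :=
  forall p, feasible_pairs m p ->
    (forall v u (t : R), Bw w v -> Bw w u -> 0 <= t <= 1 ->
       Rm (fun x => t * v x + (1 - t) * u x) p
       <= t * Rm v p + (1 - t) * Rm u p) /\
    (forall v (l : R), Bw w v -> 0 <= l ->
       Rm (fun x => l * v x) p = l * Rm v p).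

Definition policy_risk (m : mcp) (Rm : (X -> R) -> X * A -> R)
    (pi : R.-pker X ~> A) (v : X -> R) : X -> R :=
  fun x => \int[pi x]_(a in mcp_feasible m x) Rm v (x, a).

Definition upper_envelope (m : mcp) (w : X -> R) (K : R)
    (Rm Rbar : (X -> R) -> X * A -> R) : Prop :=
  [/\ risk_map m w Rbar, coherent m w Rbar &
      forall v u p, BwK w K v -> BwK w K u -> feasible_pairs m p ->
        Rm v p - Rm u p <= Rbar (fun x => v x - u x) p].

End markov_control_process.

(* Main.v *)
Require Import Defs.
From HB Require Import structures.
From mathcomp Require Import all_boot all_order all_algebra.
From mathcomp Require Import all_classical all_reals all_analysis.
From mathcomp Require Import measurable_realfun.
From mathcomp Require Import ring lra.

Set Implicit Arguments.
Unset Strict Implicit.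
Unset Printing Implicit Defensive.

Import Order.TTheory GRing.Theory Num.Theory.
Import numFieldNormedType.Exports.

Local Open Scope classical_set_scope.
Local Open Scope ring_scope.

(** The upper envelope bounds the difference of R_{x,a}(v) - R_{x,a}(u) at (x,a)
    and (y,b) by Rbar_{x,a}(f) + Rbar_{y,b}(-f), where f := v - u; a bound
    uniform in the actions is then integrated against the policy. If the
    seminorm of f for the weight g := 1 + beta w0 is at most L, then f is within
    L g of a constant, and the constant cancels in the sum. As for Harris
    chains, one concludes by a dichotomy: if w0 x + w0 y exceeds r, the drift
    condition alone contracts; otherwise x and y both lie in the small set,
    where the minorization gains 2 alpha L. The first case is the second with
    alpha = 0, since monotonicity is a minorization with constant 0. Applied to
    v and the constant its weighted seminorm centers it at, the envelope also
    bounds a |-> R_{x,a}(v), which makes it integrable against the policy. *)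

Section Rintegral_bounds.
Context (R : realType) (d : measure_display) (T : measurableType d).
Variables (P : {measure set T -> \bar R}) (D : set T).
Hypotheses (mD : measurable D) (PD : P D = 1%E).

Let integrable_cst (c : R) : P.-integrable D (EFin \o cst c).
Proof.
apply: measurable_bounded_integrable => //; last exact: bounded_cst.
by rewrite PD ltry.
Qed.

Let Rintegral_cst_carrier (c : R) : \int[P]_(x in D) cst c x = c.
Proof. by rewrite Rintegral_cst // PD mulr1. Qed.

Lemma Rintegral_le_cst (f : T -> R) c : P.-integrable D (EFin \o f) ->
  (forall x, D x -> f x <= c) -> \int[P]_(x in D) f x <= c.
Proof.
by move=> fi fc; rewrite -(Rintegral_cst_carrier c); exact: le_Rintegral.
Qed.

Lemma Rintegral_ge_cst (f : T -> R) c : P.-integrable D (EFin \o f) ->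
  (forall x, D x -> c <= f x) -> c <= \int[P]_(x in D) f x.
Proof.
by move=> fi cf; rewrite -(Rintegral_cst_carrier c); exact: le_Rintegral.
Qed.

End Rintegral_bounds.

Lemma Rintegral_gap_le (R : realType) (d1 d2 : measure_display)
    (T1 : measurableType d1) (T2 : measurableType d2)
    (P : {measure set T1 -> \bar R}) (Q : {measure set T2 -> \bar R})
    (D : set T1) (E : set T2) (f : T1 -> R) (g : T2 -> R) c :
  measurable D -> measurable E -> P D = 1%E -> Q E = 1%E ->
  P.-integrable D (EFin \o f) -> Q.-integrable E (EFin \o g) ->
  (forall a b, D a -> E b -> f a - g b <= c) ->
  \int[P]_(a in D) f a - \int[Q]_(b in E) g b <= c.
Proof.
move=> mD mE PD QE fi gi fg; rewrite lerBlDr.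
apply: Rintegral_le_cst => // a Da; rewrite -lerBlDl.
by apply: Rintegral_ge_cst => // b Eb; rewrite lerBlDl -lerBlDr; exact: fg.
Qed.

Section weighted_seminorm.
Context (R : realType) (d : measure_display) (X : measurableType d).
Implicit Types (w u v : X -> R).

Lemma wseminormP w v (L : R) : (forall x, 0 < w x) ->
  (wseminorm w v <= L%:E)%E <->
  0 <= L /\ forall x y, `|v x - v y| <= L * (w x + w y).
Proof.
move=> w_gt0; rewrite /wseminorm ge_max lee_fin; split.
  move=> /andP[L_ge0 vL]; split=> // x y.
  have [->|/eqP xy] := eqVneq x y.
    by rewrite subrr normr0 mulr_ge0 // addr_ge0 // ltW.
  rewrite -ler_pdivrMr ?addr_gt0 // -lee_fin; apply: le_trans vL.
  by apply: ereal_sup_ubound; exists (x, y).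
move=> [-> vL] /=; apply: ge_ereal_sup => _ [[x y] _ <-].
by rewrite lee_fin ler_pdivrMr ?addr_gt0.
Qed.

Lemma wseminorm_ge0 w v : (0 <= wseminorm w v)%E.
Proof. by rewrite /wseminorm le_max lexx. Qed.

Lemma wseminorm_leM w u v (k : R) : (forall x, 0 < w x) -> 0 < k ->
  (forall L, 0 <= L -> (forall x y, `|u x - u y| <= L * (w x + w y)) ->
     forall x y, v x - v y <= k * L * (w x + w y)) ->
  (wseminorm w v <= k%:E * wseminorm w u)%E.
Proof.
move=> w_gt0 k_gt0 uv.
have := wseminorm_ge0 w u; case E : (wseminorm w u) => [L||] // _; last first.
  by rewrite gt0_muley ?leey.
have /(wseminormP _ _ w_gt0)[L_ge0 uL] : (wseminorm w u <= L%:E)%E by rewrite E.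
rewrite -EFinM; apply/wseminormP => //; split=> [|x y].
  by rewrite mulr_ge0 // ltW.
rewrite ler_norml; apply/andP; split; last exact: uv.
by rewrite lerNl opprB [X in _ * X]addrC; exact: uv.
Qed.

(* The supremum of v - L w lies below the infimum of v + L w, and c may be any
   number in between. *)
Lemma wseminorm_center w v (L : R) :
  (forall x y, `|v x - v y| <= L * (w x + w y)) ->
  exists c, forall x, `|v x - c| <= L * w x.
Proof.
move=> vL; pose E := range (fun x => v x - L * w x).
have ubE y : ubound E (v y + L * w y).
  move=> _ [x _ <-]; have := le_trans (ler_norm _) (vL x y); lra.
exists (sup E) => x.
have sup_le : sup E <= v x + L * w x.
  by apply: ge_sup => //; exists (v x - L * w x), x.
have le_sup : v x - L * w x <= sup E.
  by apply: ub_le_sup; [exists (v x + L * w x) | exists x].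
by rewrite ler_distlC; apply/andP; split; lra.
Qed.

End weighted_seminorm.

Section weighted_space.
Context (R : realType) (d : measure_display) (X : measurableType d).
Variable w : X -> R.
Hypothesis w_gt0 : forall x, 0 < w x.
Implicit Types (u v : X -> R).

Lemma BwP u :
  Bw w u <-> measurable_fun [set: X] u /\ exists C, forall x, `|u x| <= C * w x.
Proof.
split=> -[mu ub]; split=> //; last first.
  have [C uC] := ub; apply: (@le_lt_trans _ _ C%:E); last exact: ltry.
  by apply: ge_ereal_sup => _ [x _ <-]; rewrite lee_fin ler_pdivrMr.
have u_le x : ((`|u x| / w x)%:E <= wnorm w u)%E.
  by apply: ereal_sup_ubound; exists x.
exists (fine (wnorm w u)) => x; rewrite -ler_pdivrMr // -lee_fin fineK //.
by rewrite ge0_fin_numE // (le_trans _ (u_le x)) // lee_fin divr_ge0 // ltW.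
Qed.

Lemma Bw_weight : measurable_fun [set: X] w -> Bw w w.
Proof.
by move=> mw; apply/BwP; split=> //; exists 1 => x; rewrite mul1r gtr0_norm.
Qed.

Lemma Bw_cst (c : R) : (forall x, 1 <= w x) -> Bw w (fun=> c).
Proof.
move=> w_ge1; apply/BwP; split; first exact: measurable_cst.
by exists `|c| => x; rewrite ler_peMr.
Qed.

Lemma BwZ (c : R) u : Bw w u -> Bw w (fun x => c * u x).
Proof.
move=> /BwP[mu [C uC]]; apply/BwP; split.
  by apply: measurable_funM => //; exact: measurable_cst.
by exists (`|c| * C) => x; rewrite normrM -mulrA ler_wpM2l.
Qed.

Lemma BwD u v : Bw w u -> Bw w v -> Bw w (fun x => u x + v x).
Proof.
move=> /BwP[mu [C uC]] /BwP[mv [D vD]]; apply/BwP; split.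
  exact: measurable_funD.
by exists (C + D) => x; rewrite mulrDl (le_trans (ler_normD _ _)) ?lerD.
Qed.

Lemma BwN u : Bw w u -> Bw w (fun x => - u x).
Proof.
by move=> /(BwZ (-1)); under [X in Bw w X -> _]eq_fun do rewrite mulN1r.
Qed.

Lemma BwB u v : Bw w u -> Bw w v -> Bw w (fun x => u x - v x).
Proof. by move=> Bu /BwN; exact: BwD. Qed.

Lemma BwKB (K : R) u v : BwK w K u -> BwK w K v -> Bw w (fun x => u x - v x).
Proof. by move=> [Bu _] [Bv _]; exact: BwB. Qed.

Lemma Bw_integrable (mu : {measure set X -> \bar R}) u :
  mu.-integrable [set: X] (EFin \o w) -> Bw w u ->
  mu.-integrable [set: X] (EFin \o u).
Proof.
move=> wi /BwP[mu_u [C uC]].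
apply: (le_integrable measurableT _ _ (integrableZl measurableT C wi)).
  exact/measurable_EFinP.
by move=> x _ /=; rewrite lee_fin (le_trans (uC x)) // ler_norm.
Qed.

Lemma BwK_cst (K c : R) : (forall x, 1 <= w x) -> 0 <= K -> BwK w K (fun=> c).
Proof.
move=> w_ge1 K_ge0; split; first exact: Bw_cst.
apply/wseminormP => //; split=> // x y.
by rewrite subrr normr0 mulr_ge0 // addr_ge0 // ltW.
Qed.

End weighted_space.

Lemma sub_Bw (R : realType) (d : measure_display) (X : measurableType d)
    (w w' : X -> R) (C : R) :
  (forall x, 0 < w x) -> (forall x, 0 < w' x) -> (forall x, w x <= C * w' x) ->
  Bw w `<=` Bw w'.
Proof.
move=> w_gt0 w'_gt0 ww' u /(BwP w_gt0)[mu [D uD]]; apply/BwP => //; split=> //.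
exists (D * C) => x; apply: le_trans (uD x) _; rewrite -mulrA ler_wpM2l //.
by rewrite -(pmulr_lge0 _ (w_gt0 x)) (le_trans _ (uD x)).
Qed.

Section affine_weight.
Context (R : realType) (d : measure_display) (X : measurableType d).
Variables (w0 : X -> R) (b : R).
Hypothesis w0_meas : measurable_fun [set: X] w0.
Hypothesis w0_ge0 : forall x, 0 <= w0 x.

Lemma affine_weight_ge1 : 0 <= b -> forall x, 1 <= 1 + b * w0 x.
Proof. by move=> b_ge0 x; rewrite lerDl mulr_ge0. Qed.

Lemma measurable_affine_weight :
  measurable_fun [set: X] (fun x => 1 + b * w0 x).
Proof.
apply: measurable_funD; first exact: measurable_cst.
by apply: measurable_funM => //; exact: measurable_cst.
Qed.

Lemma integrable_affine_weight (mu : {finite_measure set X -> \bar R}) :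
  (\int[mu]_x (w0 x)%:E < +oo)%E ->
  mu.-integrable [set: X] (EFin \o (fun x => 1 + b * w0 x)).
Proof.
move=> w0_fin; have w0_int : mu.-integrable [set: X] (EFin \o w0).
  apply/integrableP; split; first exact/measurable_EFinP.
  by under eq_integral do rewrite /= ger0_norm //.
have one_int : mu.-integrable [set: X] (EFin \o cst 1).
  exact: finite_measure_integrable_cst.
exact: (integrableD measurableT one_int (integrableZl measurableT b w0_int)).
Qed.

Lemma mem_Bw_affine_weight : 0 < b -> Bw (fun x => 1 + b * w0 x) w0.
Proof.
move=> b_gt0; apply/BwP => [x|].
  exact: lt_le_trans (affine_weight_ge1 (ltW b_gt0) x).
split=> //; exists b^-1 => x; rewrite mulrDr mulr1 mulKf ?gt_eqF //.
by rewrite ger0_norm // lerDr invr_ge0 ltW.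
Qed.

Lemma Bw_affine_weight : 0 < b ->
  Bw (fun x => 1 + b * w0 x) = Bw (fun x => 1 + w0 x).
Proof.
move=> b_gt0; have w_gt0 x : 0 < 1 + w0 x by rewrite ltr_pwDl.
have wb_gt0 x : 0 < 1 + b * w0 x by rewrite ltr_pwDl // mulr_ge0 // ltW.
apply/seteqP; split.
  by apply: (@sub_Bw _ _ _ _ _ (1 + b)) => // x; have := w0_ge0 x; nra.
apply: (@sub_Bw _ _ _ _ _ (1 + b^-1)) => // x.
rewrite mulrDl mul1r mulrDr mulr1 mulKf ?gt_eqF //.
have : 0 <= b * w0 x by rewrite mulr_ge0 // ltW.
have : 0 < b^-1 by rewrite invr_gt0.
lra.
Qed.

End affine_weight.

Section monetary_functionals.
Context (R : realType) (d : measure_display) (X : measurableType d).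
Variable w : X -> R.
Hypothesis w_ge1 : forall x, 1 <= w x.
Implicit Types (F G : (X -> R) -> R) (u v f g : X -> R).

Let w_gt0 x : 0 < w x.
Proof. exact: lt_le_trans (w_ge1 x). Qed.

Definition monetary F : Prop :=
  [/\ forall v u, Bw w v -> Bw w u -> (forall x, v x <= u x) -> F v <= F u,
      forall v c, Bw w v -> F (fun x => v x + c) = F v + c
    & F (fun=> 0) = 0].

Definition positively_homogeneous F : Prop :=
  forall v l, Bw w v -> 0 <= l -> F (fun x => l * v x) = l * F v.

Definition minorized (mu : {measure set X -> \bar R}) (a : R) F : Prop :=
  forall v u, Bw w v -> Bw w u -> (forall x, u x <= v x) ->
    a * \int[mu]_x (v x - u x) <= F v - F u.

Lemma monetary_minorized0 mu F : monetary F -> minorized mu 0 F.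
Proof.
by move=> [F_mono _ _] v u Bv Bu uv; rewrite mul0r subr_ge0; exact: F_mono.
Qed.

Lemma monetary_cst F c : monetary F -> F (fun=> c) = c.
Proof.
move=> [_ F_tr F0].
have <- : (fun x : X => 0 + c) = (fun=> c).
  by apply/funext => x; rewrite add0r.
by rewrite (F_tr (fun=> 0)) ?F0 ?add0r //; exact: Bw_cst.
Qed.

Lemma monetary_affine F g c l : monetary F -> positively_homogeneous F ->
  Bw w g -> 0 <= l -> F (fun x => c + l * g x) = c + l * F g.
Proof.
move=> [_ F_tr _] F_hom Bg l_ge0; under eq_fun do rewrite addrC.
by rewrite F_tr ?F_hom 1?addrC //; exact: BwZ.
Qed.

Lemma monetary_le F f g l : monetary F -> positively_homogeneous F ->
  Bw w f -> Bw w g -> 0 <= l -> (forall x, f x <= l * g x) -> F f <= l * F g.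
Proof.
move=> [F_mono _ _] F_hom Bf Bg l_ge0 fg.
by rewrite -F_hom //; apply: F_mono => //; exact: BwZ.
Qed.

(* Minorize F along f <= c + L g and G along - f <= - c + L g: both the center c
   and f itself cancel in the sum. *)
Lemma minorized_pair_le (mu : {measure set X -> \bar R}) F G a f g c L :
  mu.-integrable [set: X] (EFin \o w) ->
  monetary F -> positively_homogeneous F -> minorized mu a F ->
  monetary G -> positively_homogeneous G -> minorized mu a G ->
  Bw w f -> Bw w g -> 0 <= L -> (forall x, `|f x - c| <= L * g x) ->
  F f + G (fun x => - f x) <= L * (F g + G g - 2 * a * \int[mu]_x g x).
Proof.
move=> wi F_mon F_hom F_min G_mon G_hom G_min Bf Bg L_ge0 fgc.
have Bw_int u : Bw w u -> mu.-integrable [set: X] (EFin \o u).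
  exact: Bw_integrable.
have BNf := BwN w_gt0 Bf.
have B_aff k : Bw w (fun x => k + L * g x).
  by apply: (BwD w_gt0 (Bw_cst w_gt0 k w_ge1)); exact: BwZ.
have f_le x : f x <= c + L * g x.
  by rewrite -lerBlDl (le_trans (ler_norm _)).
have f_ge x : - f x <= - c + L * g x.
  by rewrite -lerBlDl opprK addrC (le_trans (ler_norm _)) // distrC.
have := F_min _ _ (B_aff c) Bf f_le; have := G_min _ _ (B_aff (- c)) BNf f_ge.
rewrite !monetary_affine //.
have : \int[mu]_x (c + L * g x - f x) + \int[mu]_x (- c + L * g x - - f x)
    = 2 * L * \int[mu]_x g x.
  rewrite -RintegralD -?RintegralZl //; try by apply/Bw_int/BwB.
  - by apply: eq_Rintegral => x _; ring.
  - exact: Bw_int.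
by move=> /(congr1 ( *%R a)); lra.
Qed.

End monetary_functionals.

(* [n] stands for w0 x + w0 y. *)
Definition harris_rate (R : realFieldType) (gamma Kb alpha r beta abar : R)
    : Prop :=
  forall n, 0 <= n ->
    2 + beta * (gamma * n + 2 * Kb) - 2 * (if n <= r then alpha else 0)
    <= abar * (2 + beta * n).

(* For n > r the drift alone contracts, since gamma r + 2 Kb < r; for n <= r,
   beta = alpha / (2 Kb) spends half of the gain 2 alpha on the drift
   constant 2 beta Kb = alpha. *)
Lemma exists_harris_rate (R : realFieldType) (gamma Kb alpha r : R) :
  0 < gamma < 1 -> 0 < Kb -> 0 < alpha -> 2 * Kb / (1 - gamma) < r ->
  exists abar beta : R,
    [/\ 0 < abar < 1, 0 < beta & harris_rate gamma Kb alpha r beta abar].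
Proof.
move=> /andP[gamma_gt0 gamma_lt1] Kb_gt0 alpha_gt0 r_gt.
have r_gt0 : 0 < r.
  by apply: le_lt_trans r_gt; rewrite divr_ge0 ?subr_ge0 ?mulr_ge0 // ltW.
have drift_lt : gamma * r + 2 * Kb < r.
  by move: r_gt; rewrite ltr_pdivrMr ?subr_gt0 //; lra.
have [beta beta_gt0 beta_Kb] : exists2 beta, 0 < beta & beta * (2 * Kb) = alpha.
  exists (alpha / (2 * Kb)); first by rewrite divr_gt0 // mulr_gt0.
  by rewrite divfK // gt_eqF // mulr_gt0.
have den_gt0 : 0 < 2 + beta * r by rewrite addr_gt0 // mulr_gt0.
pose rate_far := (2 + beta * (gamma * r + 2 * Kb)) / (2 + beta * r).
pose abar := Num.max (Num.max gamma (1 - alpha / 2)) rate_far.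
have gamma_le : gamma <= abar by rewrite !le_max lexx.
have alpha_le : 1 - alpha / 2 <= abar by rewrite !le_max lexx orbT.
have far_le : 2 + beta * (gamma * r + 2 * Kb) <= abar * (2 + beta * r).
  by rewrite -ler_pdivrMr // !le_max lexx orbT.
exists abar, beta; split=> // [|n n_ge0].
  rewrite (lt_le_trans gamma_gt0) //= !gt_max gamma_lt1 ltr_pdivrMr // mul1r.
  by rewrite ltrD2l ltr_pM2l // drift_lt andbT gtrBl divr_gt0.
case: (leP n r) => [n_le|n_gt].
  have : gamma * (beta * n) <= abar * (beta * n).
    by rewrite ler_wpM2r // mulr_ge0 // ltW.
  by lra.
have : gamma * (beta * (n - r)) <= abar * (beta * (n - r)).
  by rewrite ler_wpM2r // mulr_ge0 ?subr_ge0 // ltW.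
by lra.
Qed.

Lemma policy_risk_gap_le (R : realType) (dX dA : measure_display)
    (X : measurableType dX) (A : measurableType dA) (m : mcp R X A)
    (Rm : (X -> R) -> X * A -> R) (pi : R.-pker X ~> A) (v u : X -> R) x y C :
  policy m pi ->
  (forall z, (pi z).-integrable (mcp_feasible m z)
                                (EFin \o (fun a => Rm v (z, a)))) ->
  (forall z, (pi z).-integrable (mcp_feasible m z)
                                (EFin \o (fun a => Rm u (z, a)))) ->
  (forall a b, mcp_feasible m x a -> mcp_feasible m y b ->
     (Rm v (x, a) - Rm u (x, a)) - (Rm v (y, b) - Rm u (y, b)) <= C) ->
  (policy_risk m Rm pi v x - policy_risk m Rm pi u x)
    - (policy_risk m Rm pi v y - policy_risk m Rm pi u y) <= C.
Proof.
move=> pi_pol Rv_int Ru_int gap; have mF := mcp_feasible_measurable m.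
rewrite /policy_risk -!RintegralB //.
have diff_int z := integrableB (mF z) (Rv_int z) (Ru_int z).
exact: Rintegral_gap_le (diff_int x) (diff_int y) gap.
Qed.

Section risk_maps.
Context (R : realType) (dX dA : measure_display).
Context (X : measurableType dX) (A : measurableType dA) (m : mcp R X A).
Variables (w : X -> R) (K : R).
Hypotheses (w_ge1 : forall x, 1 <= w x) (w_meas : measurable_fun [set: X] w).
Hypothesis K_ge0 : 0 <= K.
Implicit Types (Rm Rbar : (X -> R) -> X * A -> R) (u v g : X -> R).

Let w_gt0 x : 0 < w x.
Proof. exact: lt_le_trans (w_ge1 x). Qed.

Lemma risk_map_eq_Bw (w' : X -> R) Rm :
  Bw w = Bw w' -> risk_map m w Rm -> risk_map m w' Rm.
Proof. by rewrite /risk_map /risk_measure => ->. Qed.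

Lemma risk_map_monetary Rm p :
  risk_map m w Rm -> feasible_pairs m p -> monetary w (Rm ^~ p).
Proof.
move=> [Rm_nu _] Kp; have [nu nu_risk Rm_eq] := Rm_nu p Kp.
have [nu_mono nu_tr nu_0] := nu_risk (mcp_Q m p).
split=> [v u Bv Bu vu|v c Bv|].
- by rewrite -lee_fin !Rm_eq //; exact: nu_mono.
- apply: EFin_inj; rewrite EFinD !Rm_eq //; first exact: nu_tr.
  by apply: BwD => //; exact: Bw_cst.
- by apply: EFin_inj; rewrite Rm_eq //; exact: Bw_cst.
Qed.

Lemma coherent_positively_homogeneous Rm p :
  coherent m w Rm -> feasible_pairs m p -> positively_homogeneous w (Rm ^~ p).
Proof. by move=> Rm_coh /Rm_coh[]. Qed.

Section upper_envelope.
Variables Rm Rbar : (X -> R) -> X * A -> R.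
Hypotheses (Rm_risk : risk_map m w Rm) (env : upper_envelope m w K Rm Rbar).

Let Rbar_mon p : feasible_pairs m p -> monetary w (Rbar ^~ p).
Proof. by have [Rbar_risk _ _] := env; exact: risk_map_monetary. Qed.

Let Rbar_hom p : feasible_pairs m p -> positively_homogeneous w (Rbar ^~ p).
Proof.
by have [_ Rbar_coh _] := env; exact: coherent_positively_homogeneous.
Qed.

Lemma upper_envelope_dist_le v u g L p :
  BwK w K v -> BwK w K u -> Bw w g -> 0 <= L ->
  (forall x, `|v x - u x| <= L * g x) -> feasible_pairs m p ->
  `|Rm v p - Rm u p| <= L * Rbar g p.
Proof.
move=> Kv Ku Bg L_ge0 vug Kp; have [_ _ Rbar_up] := env.
have one_sided v' u' : BwK w K v' -> BwK w K u' ->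
    (forall x, `|v' x - u' x| <= L * g x) -> Rm v' p - Rm u' p <= L * Rbar g p.
  move=> Kv' Ku' v'u'; apply: le_trans (Rbar_up _ _ _ Kv' Ku' Kp) _.
  apply: (monetary_le w_ge1 (Rbar_mon Kp) (Rbar_hom Kp)) => //.
    exact: (BwKB w_gt0 Kv' Ku').
  by move=> x; apply: le_trans (ler_norm _) (v'u' x).
rewrite ler_norml lerNl opprB !one_sided // => x.
by rewrite distrC.
Qed.

Lemma upper_envelope_dist_cst_le v : BwK w K v ->
  exists c, forall p, feasible_pairs m p -> `|Rm v p - c| <= K * Rbar w p.
Proof.
move=> Kv; have [_ /(wseminormP _ _ w_gt0)[_ /wseminorm_center[c vc]]] := Kv.
exists c => p Kp; have Rm_mon := risk_map_monetary Rm_risk Kp.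
rewrite -{1}(monetary_cst w_ge1 c Rm_mon).
by apply: upper_envelope_dist_le => //; [exact: BwK_cst | exact: Bw_weight].
Qed.

Lemma upper_envelope_gap_le (mu : {measure set X -> \bar R}) a v u g L p q :
  mu.-integrable [set: X] (EFin \o w) ->
  BwK w K v -> BwK w K u -> Bw w g -> 0 <= L ->
  (forall x y, `|(v x - u x) - (v y - u y)| <= L * (g x + g y)) ->
  feasible_pairs m p -> minorized w mu a (Rbar ^~ p) ->
  feasible_pairs m q -> minorized w mu a (Rbar ^~ q) ->
  (Rm v p - Rm u p) - (Rm v q - Rm u q)
    <= L * (Rbar g p + Rbar g q - 2 * a * \int[mu]_x g x).
Proof.
move=> wi Kv Ku Bg L_ge0 vuL Kp p_min Kq q_min; have [_ _ Rbar_up] := env.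
have [c vuc] := @wseminorm_center _ _ _ g (fun x => v x - u x) L vuL.
have Bvu := BwKB w_gt0 Kv Ku.
apply: le_trans (minorized_pair_le w_ge1 wi (Rbar_mon Kp) (Rbar_hom Kp) p_min
  (Rbar_mon Kq) (Rbar_hom Kq) q_min Bvu Bg L_ge0 vuc).
under [X in Rbar X q]eq_fun do rewrite opprB.
by rewrite opprB lerD // Rbar_up.
Qed.

Lemma policy_integrable (pi : R.-pker X ~> A) v x C :
  policy m pi -> BwK w K v ->
  (forall a, mcp_feasible m x a -> Rbar w (x, a) <= C) ->
  (pi x).-integrable (mcp_feasible m x) (EFin \o (fun a => Rm v (x, a))).
Proof.
move=> pi_pol Kv RbarC; apply: measurable_bounded_integrable.
- exact: mcp_feasible_measurable.
- by rewrite pi_pol ltry.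
- have [[Bv _] [_ /(_ _ Bv) mRm]] := (Kv, Rm_risk).
  apply: (measurable_comp (mcp_pairs_measurable m) _ mRm).
    by move=> _ [a xa <-].
  exact: measurable_funTS (pair1_measurable x).
- have [c vc] := upper_envelope_dist_cst_le Kv.
  exists (`|c| + K * C); split=> [|M /ltW CM a xa]; first exact: num_real.
  apply: le_trans CM; rewrite -[Rm v _](subrK c) addrC.
  rewrite (le_trans (ler_normD _ _)) // lerD2l.
  by rewrite (le_trans (vc _ _)) // ler_wpM2l ?RbarC.
Qed.

Lemma upper_envelope_affine_le g c b D p :
  Bw w g -> 0 <= b -> Rbar g p <= D -> feasible_pairs m p ->
  Rbar (fun x => c + b * g x) p <= c + b * D.
Proof.
move=> Bg b_ge0 gD Kp.
rewrite (monetary_affine w_ge1 c (Rbar_mon Kp) (Rbar_hom Kp)) //.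
by rewrite lerD2l ler_wpM2l.
Qed.

Lemma upper_envelope_gap_contraction (mu : probability X R) w0 gamma Kb alpha r
    abar beta v u L x y a b :
  mu.-integrable [set: X] (EFin \o w) ->
  Bw w w0 -> (forall z, 0 <= w0 z) ->
  (forall z c, feasible_pairs m (z, c) ->
     Rbar w0 (z, c) <= gamma * w0 z + Kb) ->
  (forall z c, feasible_pairs m (z, c) -> w0 z <= r ->
     minorized w mu alpha (Rbar ^~ (z, c))) ->
  0 <= alpha -> 0 <= beta ->
  harris_rate gamma Kb alpha r beta abar ->
  BwK w K v -> BwK w K u -> 0 <= L ->
  (forall z t, `|(v z - u z) - (v t - u t)|
               <= L * ((1 + beta * w0 z) + (1 + beta * w0 t))) ->
  feasible_pairs m (x, a) -> feasible_pairs m (y, b) ->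
  (Rm v (x, a) - Rm u (x, a)) - (Rm v (y, b) - Rm u (y, b))
    <= abar * L * ((1 + beta * w0 x) + (1 + beta * w0 y)).
Proof.
move=> wi Bw0 w0_ge0 drift small alpha_ge0 beta_ge0 rate Kv Ku L_ge0 vuL.
move=> Kxa Kyb.
pose n := w0 x + w0 y; pose gain := if n <= r then alpha else 0.
have gain_ge0 : 0 <= gain by rewrite /gain; case: ifP.
have minorized_gain z c : feasible_pairs m (z, c) -> w0 z <= n ->
    minorized w mu gain (Rbar ^~ (z, c)).
  rewrite /gain => Kzc zn; case: ifP => [nr|_]; last first.
    exact: monetary_minorized0 (Rbar_mon Kzc).
  exact: small Kzc (le_trans zn nr).
have x_min : minorized w mu gain (Rbar ^~ (x, a)).
  by apply: minorized_gain; rewrite ?lerDl.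
have y_min : minorized w mu gain (Rbar ^~ (y, b)).
  by apply: minorized_gain; rewrite ?lerDr.
have Bg : Bw w (fun z => 1 + beta * w0 z).
  by apply: (BwD w_gt0 (Bw_cst w_gt0 1 w_ge1)); exact: BwZ.
have g_ge1 : 1 <= \int[mu]_z (1 + beta * w0 z).
  apply: Rintegral_ge_cst => //; first exact: probability_setT.
    exact: Bw_integrable wi Bg.
  by move=> z _; rewrite lerDl mulr_ge0.
apply: le_trans
  (upper_envelope_gap_le wi Kv Ku Bg L_ge0 vuL Kxa x_min Kyb y_min) _.
rewrite [abar * L]mulrC -[leRHS]mulrA ler_wpM2l //.
have := upper_envelope_affine_le 1 Bw0 beta_ge0 (drift x a Kxa) Kxa.
have := upper_envelope_affine_le 1 Bw0 beta_ge0 (drift y b Kyb) Kyb.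
have := rate n (addr_ge0 (w0_ge0 x) (w0_ge0 y)); rewrite -/gain.
by have := ler_wpM2l gain_ge0 g_ge1; rewrite /n; lra.
Qed.

End upper_envelope.

End risk_maps.

Theorem theorem3p14 (R : realType) (dX dA : measure_display)
  (X : measurableType dX) (A : measurableType dA) (m : mcp R X A)
  (w0 : X -> R) (w0_meas : measurable_fun [set: X] w0)
  (w0_ge0 : forall x, 0 <= w0 x)
  (Rm : (X -> R) -> X * A -> R)
  (Rm_risk : risk_map m (fun x => 1 + w0 x) Rm)
  (gamma0 K0 K : R) (gamma0_bnd : 0 < gamma0 < 1) (K0_gt0 : 0 < K0)
  (K_gt : K0 < K)
  (A1 : forall x a, feasible_pairs m (x, a) ->
     Num.max (mcp_cost m (x, a) + Rm w0 (x, a))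
             (- (mcp_cost m (x, a) + Rm (fun z => - w0 z) (x, a)))
     <= gamma0 * w0 x + K0)
  (A2 : forall (v : X -> R) x y a b,
     Bw (fun z => 1 + w0 z) v -> (forall z, `|v z| <= w0 z + K) ->
     w0 x <= 2 * K0 / (1 - gamma0) -> w0 y <= 2 * K0 / (1 - gamma0) ->
     mcp_feasible m x a -> mcp_feasible m y b ->
     2 * K0 <= Rm (fun z => w0 z + K) (x, a) - Rm v (x, a)
               + Rm v (y, b) - Rm (fun z => - w0 z - K) (y, b))
  (gamma Kbar : R) (Rbar : (X -> R) -> X * A -> R)
  (gamma_bnd : 0 < gamma < 1) (Kbar_gt0 : 0 < Kbar)
  (Rbar_env : upper_envelope m (fun x => 1 + K^-1 * w0 x) K Rm Rbar)
  (B1 : forall x a, feasible_pairs m (x, a) ->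
     Rbar w0 (x, a) <= gamma * w0 x + Kbar)
  (alpha : R) (mu : probability X R) (r : R)
  (alpha_bnd : 0 < alpha < 1)
  (mu_w0 : (\int[mu]_x (w0 x)%:E < +oo)%E)
  (r_gt : 2 * Kbar / (1 - gamma) < r)
  (B2 : forall (v u : X -> R) x a,
     w0 x <= r -> mcp_feasible m x a ->
     Bw (fun z => 1 + w0 z) v -> Bw (fun z => 1 + w0 z) u ->
     (forall z, u z <= v z) ->
     alpha * \int[mu]_z (v z - u z) <= Rbar v (x, a) - Rbar u (x, a)) :
  exists alphabar beta : R,
    [/\ 0 < alphabar < 1, 0 < beta &
      forall (v u : X -> R) (pi : R.-pker X ~> A),
        BwK (fun x => 1 + K^-1 * w0 x) K v ->
        BwK (fun x => 1 + K^-1 * w0 x) K u ->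
        policy m pi ->
        (wseminorm (fun x => 1 + beta * w0 x)%R
           (fun x => policy_risk m Rm pi v x - policy_risk m Rm pi u x)%R
         <= alphabar%:E *
            wseminorm (fun x => 1 + beta * w0 x)%R (fun x => v x - u x)%R)%E].
Proof.
have [K_gt0 [alpha_gt0 _]] := (lt_trans K0_gt0 K_gt, andP alpha_bnd).
have iK_gt0 : 0 < K^-1 by rewrite invr_gt0.
have [abar [beta [abar01 beta_gt0 rate]]] :=
  exists_harris_rate gamma_bnd Kbar_gt0 alpha_gt0 r_gt.
have [abar_gt0 _] := andP abar01.
exists abar, beta; split=> // v u pi Kv Ku pi_pol.
have Bw_eq := Bw_affine_weight w0_ge0 iK_gt0; rewrite -Bw_eq in B2.
have w_ge1 := affine_weight_ge1 w0_ge0 (ltW iK_gt0).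
have w_meas := measurable_affine_weight K^-1 w0_meas.
have wi := integrable_affine_weight K^-1 w0_meas w0_ge0 mu_w0.
have Bw0 := mem_Bw_affine_weight w0_meas w0_ge0 iK_gt0.
have Rm_int f x : BwK (fun x => 1 + K^-1 * w0 x) K f ->
    (pi x).-integrable (mcp_feasible m x) (EFin \o (fun a => Rm f (x, a))).
  move=> Kf; apply: (policy_integrable w_ge1 w_meas (ltW K_gt0)
    (risk_map_eq_Bw (esym Bw_eq) Rm_risk) Rbar_env pi_pol Kf) => a xa.
  by apply: (upper_envelope_affine_le w_ge1 Rbar_env); [|exact: ltW|exact: B1|].
apply: wseminorm_leM => // [x|L L_ge0 vuL x y].
  exact: lt_le_trans (affine_weight_ge1 w0_ge0 (ltW beta_gt0) x).
apply: policy_risk_gap_le => // [z|z|a b xa yb]; try exact: Rm_int.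
apply: (upper_envelope_gap_contraction w_ge1 Rbar_env wi Bw0 w0_ge0 B1 _
  (ltW alpha_gt0) (ltW beta_gt0) rate Kv Ku L_ge0 vuL xa yb) => z c Kzc zr f g.
exact: B2.
Qed.
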